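(* Let $T=\{1,\dots,|T|\}$, $S$, $A$ be nonempty finite sets, let $c_{tsa}\in\mathbb{R}$ ($t\in T,\ s\in S,\ a\in A$) be costs, let $p_{s'\mid tsa}$ be transition probabilities, and let $X$ be the associated set of feasible state-action probabilities defined in the context. Let $\beta\in(0,1)$ and $\lambda=\frac{1}{1-\beta}$. Consider the optimization problem (MDPBL) $$\min_{x\in X,\ \eta\in\mathbb{R}}\ \frac{1}{|T|}\sum_{t\in T}\sum_{s\in S}\sum_{a\in A}\Big[c_{tsa}x_{tsa}+\lambda\, x_{tsa}\big(\beta\,(c_{tsa}-\eta)^{+}+(1-\beta)\,(\eta-c_{tsa})^{+}\big)\Big].$$ Then there exists an optimal solution $(x^*,\eta^* )$ of this problem such that $\eta^*=c_{tsa}$ for some $t\in T$, $s\in S$, $a\in A$.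
   Context: A finite, discrete-time, cyclic Markov decision process has times $T=\{1,\dots,|T|\}$ (the successor of $t$ is $t'=(t \bmod |T|)+1$), a finite state set $S$, a finite action set $A$, immediate costs $c_{tsa}\in\mathbb{R}$, and transition probabilities $p_{s'\mid tsa}\ge 0$ with $\sum_{s'\in S}p_{s'\mid tsa}=1$ for all $t,s,a$, where $p_{s'\mid tsa}$ is the probability of moving from state $s$ to state $s'$ when action $a$ is taken at time $t$. The set $\Delta$ consists of all $x=(x_{tsa})_{t\in T,s\in S,a\in A}$ with $x_{tsa}\ge 0$ and $\sum_{s\in S,a\in A}x_{tsa}=1$ for every $t\in T$. The feasible set is $$X=\Big\{x\in\Delta:\ \sum_{a\in A}x_{t'sa}=\sum_{s'\in S}\sum_{a\in A}x_{ts'a}\,p_{s\mid ts'a}\ \ \forall t\in T,\ \forall s\in S\Big\},\qquad t'=(t\bmod |T|)+1.$$ For real $y$, $(y)^{+}=\max\{y,0\}$. The variable $\eta$ is free (unconstrained real). *)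

(* Defs.v *)
From HB Require Import structures.
From mathcomp Require Import all_boot all_order all_algebra.
From mathcomp Require Import classical_sets reals.
Set Implicit Arguments.
Unset Strict Implicit.
Unset Printing Implicit Defensive.
Import Order.TTheory GRing.Theory Num.Theory.
Local Open Scope classical_set_scope.
Local Open Scope ring_scope.

(* The times 1, ..., |T| are represented by 'I_nT with nT = |T|, the time t
   being the ordinal t - 1.  The cyclic successor t' = (t mod |T|) + 1 is then
   the library's [ordS t], whose value is t.+1 %% nT. *)

Section MDP.
Variables (R : realType) (nT : nat) (S A : finType).

(* [p t s a s'] is p_{s' | tsa}: the target state is the last argument. *)
Definition transition_probabilities (p : 'I_nT -> S -> A -> S -> R) : Prop :=
  (forall t s a s', 0 <= p t s a s') /\
  (forall t s a, \sum_(s' : S) p t s a s' = 1).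

Definition Delta : set ('I_nT -> S -> A -> R) :=
  [set x | (forall t s a, 0 <= x t s a) /\
           (forall t, \sum_(s : S) \sum_(a : A) x t s a = 1)].

Definition feasible (p : 'I_nT -> S -> A -> S -> R) :
    set ('I_nT -> S -> A -> R) :=
  [set x | Delta x /\
     forall (t : 'I_nT) (s : S),
       \sum_(a : A) x (ordS t) s a =
       \sum_(s' : S) \sum_(a : A) x t s' a * p t s' a s].

Definition pos_part (y : R) : R := Num.max y 0.

Definition mdpbl_objective (c : 'I_nT -> S -> A -> R) (beta lambda : R)
    (x : 'I_nT -> S -> A -> R) (eta : R) : R :=
  1 / nT%:R *
  \sum_(t < nT) \sum_(s : S) \sum_(a : A)
    (c t s a * x t s a +
     lambda * x t s a * (beta * pos_part (c t s a - eta) +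
                         (1 - beta) * pos_part (eta - c t s a))).

Definition mdpbl_optimal (c : 'I_nT -> S -> A -> R)
    (p : 'I_nT -> S -> A -> S -> R) (beta lambda : R)
    (x : 'I_nT -> S -> A -> R) (eta : R) : Prop :=
  feasible p x /\
  forall (y : 'I_nT -> S -> A -> R) (zeta : R), feasible p y ->
    mdpbl_objective c beta lambda x eta <=
    mdpbl_objective c beta lambda y zeta.

End MDP.

(* Main.v *)
Require Import Defs.
From HB Require Import structures.
From mathcomp Require Import all_boot all_order all_algebra.
From mathcomp Require Import classical_sets reals.
From mathcomp Require Import ring.
From mathcomp Require Import boolp topology normedtype derive.
Set Implicit Arguments.
Unset Strict Implicit.
Unset Printing Implicit Defensive.
Import Order.TTheory GRing.Theory Num.Theory.
Import numFieldNormedType.Exports.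
Local Open Scope ring_scope.

(** For a fixed feasible x, the objective is, as a function of eta, a constant
    plus a nonnegative combination of pinball losses whose kinks are the costs
    c_{tsa}.  Such a function is affine between consecutive costs, nonincreasing
    below the smallest one and nondecreasing above the largest one, so any
    value of eta can be replaced by some cost without increasing the objective
    ([pinball_loss_data_point], [objective_data_point]).  This leaves finitely
    many values of eta to compare.

    For each of these values the objective is linear, hence continuous
    ([continuous_objective]), in x, and the feasible set is compact, being
    closed in a product of unit intervals ([feasible_compact]); so a best x
    exists once the feasible set is known to be nonempty, and the best of the
    finitely many pairs obtained is a global optimum.

    Nonemptiness ([feasible_nonempty]) is the existence of a stationary
    distribution for the chain on time-state pairs obtained by always playing
    one action.  That existence is proved algebraically
    ([stationary_distribution]): a stochastic matrix has the eigenvalue 1, and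
    the absolute value of a left eigenvector for it is again an eigenvector. *)

(** * Stationary distributions and nonemptiness of the feasible set *)

(** The constant column is killed by [1%:M - M], which is thus singular and has
    a nonzero left kernel too. *)
Lemma stochastic_fixed_vector (F : fieldType) n (M : 'M[F]_n) (i0 : 'I_n) :
  (forall i, \sum_j M i j = 1) -> exists2 v : 'rV[F]_n, v != 0 & v *m M = v.
Proof.
move=> M1; have /det0P[v v0] : \det (1%:M - M) == 0.
  rewrite -det_tr; apply/det0P; exists (const_mx 1).
    by apply/eqP => /rowP/(_ i0)/eqP; rewrite !mxE oner_eq0.
  apply/rowP => i; rewrite !mxE; under eq_bigr do rewrite !mxE mul1r.
  rewrite sumrB M1 (bigD1 i) //= eqxx big1 ?addr0 ?subrr // => j /negPf ji.
  by rewrite eq_sym ji.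
by rewrite mulmxBr mulmx1 => /eqP; rewrite subr_eq0 eq_sym => /eqP; exists v.
Qed.

(** If [u] is a fixed row vector, the triangle inequality gives [|u| <= |u| P]
    entrywise; both sides have the same total mass because the rows of [P] sum
    to 1, so equality holds in every entry, and [|u|] need only be
    normalized. *)
Lemma stationary_distribution (F : realFieldType) (Z : finType) (z0 : Z)
    (P : Z -> Z -> F) :
  (forall z z', 0 <= P z z') -> (forall z, \sum_z' P z z' = 1) ->
  exists mu : Z -> F, [/\ forall z, 0 <= mu z, \sum_z mu z = 1 &
    forall z', \sum_z mu z * P z z' = mu z'].
Proof.
move=> P_ge0 P1.
have sum_enum (G : Z -> F) : \sum_(i < #|Z|) G (enum_val i) = \sum_z G z.
  by rewrite -(big_enum_val G).
pose M : 'M[F]_#|Z| := \matrix_(i, j) P (enum_val i) (enum_val j).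
have [|v v0 vM] := @stochastic_fixed_vector F _ M (enum_rank z0).
  move=> i; rewrite -[RHS](P1 (enum_val i)) -sum_enum.
  by apply: eq_bigr => j _; rewrite mxE.
pose u z := v 0 (enum_rank z).
have uP z' : u z' = \sum_z u z * P z z'.
  rewrite {1}/u -vM mxE -sum_enum; apply: eq_bigr => i _.
  by rewrite mxE /u enum_valK enum_rankK.
have le_absP z' : `|u z'| <= \sum_z `|u z| * P z z'.
  rewrite uP; apply: le_trans (ler_norm_sum _ _ _) _.
  by apply: ler_sum => z _; rewrite normrM (ger0_norm (P_ge0 _ _)).
have sum_absP : \sum_z' \sum_z `|u z| * P z z' = \sum_z `|u z|.
  by rewrite exchange_big; apply: eq_bigr => z _; rewrite -mulr_sumr P1 mulr1.
have absP z' : \sum_z `|u z| * P z z' = `|u z'|.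
  apply/eqP; rewrite -subr_eq0; apply/eqP; move: z' isT.
  apply: psumr_eq0P => [z _|]; first by rewrite subr_ge0.
  by rewrite sumrB sum_absP subrr.
have abs_gt0 : 0 < \sum_z `|u z|.
  rewrite lt_neqAle sumr_ge0 // andbT eq_sym; apply: contraNneq v0 => u0.
  apply/eqP/rowP => i; rewrite mxE -(enum_valK i).
  by apply/eqP; rewrite -normr_eq0; apply/eqP; apply: (psumr_eq0P _ u0).
exists (fun z => `|u z| / \sum_z `|u z|); split=> [z||z'].
- by rewrite divr_ge0 // ltW.
- by rewrite -mulr_suml divff // gt_eqF.
- rewrite -[in RHS]absP mulr_suml; apply: eq_bigr => z _.
  by rewrite mulrAC.
Qed.

Lemma ordS_constant (T : Type) n (f : 'I_n -> T) :
  (forall t, f (ordS t) = f t) -> forall t t', f t = f t'.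
Proof.
case: n f => [|n] f fS; first by case.
suff f0 t : f t = f ord0 by move=> t t'; rewrite !f0.
case: t => m; elim: m => [|m IHm] lt_mn; first by congr f; apply: val_inj.
rewrite -(IHm (ltnW lt_mn)) -[RHS]fS; congr f; apply: val_inj.
by rewrite /= modn_small.
Qed.

Lemma sum_pair (V : nmodType) (I J : finType) (F : I * J -> V) :
  \sum_z F z = \sum_i \sum_j F (i, j).
Proof. by rewrite pair_bigA; apply: eq_bigr => -[]. Qed.

(** Time is made part of the state, so that the cyclic inhomogeneous chain
    becomes a homogeneous one.  A stationary distribution of it gives all times
    the same mass, because the mass of [t] moves entirely to [ordS t]; that
    mass is [1 / nT], and multiplying by [nT] makes each time slice sum to 1. *)
Lemma feasible_nonempty (R : realType) nT (S A : finType)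
    (p : 'I_nT -> S -> A -> S -> R) (t0 : 'I_nT) (s0 : S) (a0 : A) :
  transition_probabilities p -> exists x, feasible p x.
Proof.
move=> [p_ge0 p1].
pose P (z z' : 'I_nT * S) :=
  if z'.1 == ordS z.1 then p z.1 z.2 a0 z'.2 else 0.
have P_ge0 z z' : 0 <= P z z' by rewrite /P; case: ifP.
have P1 z : \sum_z' P z z' = 1.
  rewrite sum_pair (bigD1 (ordS z.1)) //=.
  rewrite [X in _ + X]big1 ?addr0 => [|t /negPf tz].
    by rewrite -[RHS](p1 z.1 z.2 a0); apply: eq_bigr => s _; rewrite /P eqxx.
  by apply: big1 => s _; rewrite /P /= tz.
have [mu [mu_ge0 mu1 muP]] := stationary_distribution (t0, s0) P_ge0 P1.
have muS t s : \sum_s' mu (t, s') * p t s' a0 s = mu (ordS t, s).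
  rewrite -muP sum_pair [RHS](bigD1 t) //=.
  rewrite [X in _ = _ + X]big1 ?addr0 => [|t' /negPf tt'].
    by apply: eq_bigr => s' _; rewrite /P eqxx.
  apply: big1 => s' _; rewrite /P /= (inj_eq (can_inj (@ordSK _))) eq_sym tt'.
  by rewrite mulr0.
pose mass t := \sum_s mu (t, s).
have massS t : mass (ordS t) = mass t.
  rewrite /mass; under eq_bigr do rewrite -muS.
  rewrite exchange_big; apply: eq_bigr => s _.
  by rewrite -mulr_sumr p1 mulr1.
have massE t : nT%:R * mass t = 1.
  rewrite -[RHS]mu1 sum_pair.
  under eq_bigr => t' _ do rewrite -/(mass t') (ordS_constant massS t' t).
  by rewrite sumr_const card_ord mulr_natl.
pose x t s a := if a == a0 then nT%:R * mu (t, s) else 0.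
have sum_x t s (G : A -> R) : \sum_a x t s a * G a = nT%:R * mu (t, s) * G a0.
  rewrite (bigD1 a0) //= /x eqxx big1 ?addr0 // => a /negPf ->.
  by rewrite mul0r.
have sum_x1 t s : \sum_a x t s a = nT%:R * mu (t, s).
  rewrite -[RHS]mulr1 -(sum_x t s (fun=> 1)).
  by apply: eq_bigr => a; rewrite mulr1.
exists x; split; first split=> [t s a|t].
- by rewrite /x; case: ifP => // _; rewrite mulr_ge0.
- by under eq_bigr do rewrite sum_x1; rewrite -mulr_sumr massE.
- move=> t s; rewrite sum_x1 -muS mulr_sumr; apply: eq_bigr => s' _.
  by rewrite sum_x mulrA.
Qed.

(** * Attainment for a fixed threshold *)

Section Compactness.
Import ArrowAsProduct.
Local Open Scope classical_set_scope.
Variables (R : realType) (nT : nat) (S A : finType).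
Local Notation profile := ('I_nT -> S -> A -> R).

Lemma continuous_entry (t : 'I_nT) (s : S) (a : A) :
  continuous (fun x : profile => x t s a).
Proof.
move=> x.
apply: (@continuous_comp _ _ _ (fun x : profile => x t s) (fun y => y a)).
  apply: (@continuous_comp _ _ _ (fun x : profile => x t) (fun y => y s)).
    exact: proj_continuous.
  exact: proj_continuous.
exact: proj_continuous.
Qed.

Lemma continuous_sum (T : topologicalType) (I : finType) (F : I -> T -> R) :
  (forall i, continuous (F i)) -> continuous (fun x => \sum_i F i x).
Proof. by move=> cF; apply: continuous_big => // x; apply: add_continuous. Qed.

Lemma continuous_mulr (T : topologicalType) (f : T -> R) (b : R) :
  continuous f -> continuous (fun x => f x * b).
Proof. by move=> cf x; apply: cvgMr_tmp; exact: cf. Qed.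

Lemma closed_eq_continuous (T : topologicalType) (f g : T -> R) :
  continuous f -> continuous g -> closed [set x | f x = g x].
Proof.
move=> cf cg.
rewrite [X in closed X](_ : _ = (f \- g) @^-1` [set 0]).
  apply: preimage_closed; last exact: closed_eq.
  by move=> x _; apply: cvgB; [exact: cf|exact: cg].
by apply/seteqP; split=> x /= => [->|/subr0_eq//]; rewrite subrr.
Qed.

(** Each constraint defining the feasible set is a closed condition on
    continuous functions of finitely many entries. *)
Lemma feasible_closed (p : 'I_nT -> S -> A -> S -> R) : closed (feasible p).
Proof.
rewrite [X in closed X](_ : _ =
  (\bigcap_t \bigcap_s \bigcap_a [set x : profile | 0 <= x t s a]) `&`
  (\bigcap_t [set x : profile | \sum_s \sum_a x t s a = 1]) `&`
  (\bigcap_t \bigcap_s [set x : profile | \sum_a x (ordS t) s a =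
       \sum_s' \sum_a x t s' a * p t s' a s])); last first.
  apply/seteqP; split=> x /=.
    move=> [[x0 x1] xP]; split; first split; move=> t _ //.
    - by move=> s _ a _; exact: x0.
    - by move=> s _; exact: xP.
  move=> [[x0 x1] xP]; split; first split.
  - by move=> t s a; exact: x0.
  - by move=> t; exact: x1.
  - by move=> t s; exact: xP.
apply: closedI; first apply: closedI.
- apply: closed_bigI => t _; apply: closed_bigI => s _.
  apply: closed_bigI => a _.
  apply: (@preimage_closed _ _ (fun x : profile => x t s a) [set y | 0 <= y]).
    by move=> x _; exact: continuous_entry.
  exact: closed_ge.
- apply: closed_bigI => t _; apply: closed_eq_continuous.
    apply: continuous_sum => s; apply: continuous_sum => a.
    exact: continuous_entry.
  exact: cst_continuous.
- apply: closed_bigI => t _; apply: closed_bigI => s _.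
  apply: closed_eq_continuous.
    by apply: continuous_sum => a; exact: continuous_entry.
  apply: continuous_sum => s'; apply: continuous_sum => a.
  exact/continuous_mulr/continuous_entry.
Qed.

(** The entries at a given time are nonnegative with sum 1, so they all lie in
    the unit interval and Tychonoff's theorem bounds the feasible set by a
    compact one. *)
Lemma feasible_compact (p : 'I_nT -> S -> A -> S -> R) : compact (feasible p).
Proof.
have cube_compact :
    compact [set x : profile | forall t s a, `[0 : R, 1] (x t s a)].
  (* A profile is an iterated function, hence one product per argument. *)
  have compact_A := @tychonoff A (fun=> R) _ (fun=> @segment_compact R 0 1).
  have compact_SA := @tychonoff S (fun=> A -> R) _ (fun=> compact_A).
  exact: (@tychonoff 'I_nT (fun=> S -> A -> R) _ (fun=> compact_SA)).
apply: (subclosed_compact (@feasible_closed p) cube_compact).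
move=> x [[x0 x1] _] t s a /=; rewrite in_itv /= x0 /= -(x1 t).
rewrite (bigD1 s) //= (bigD1 a) //= -addrA lerDl addr_ge0 ?sumr_ge0 //.
by move=> s' _; rewrite sumr_ge0.
Qed.

Lemma feasible_min (p : 'I_nT -> S -> A -> S -> R)
    (f : profile -> R) :
  (exists x, feasible p x) -> continuous f ->
  exists2 x, feasible p x & forall y, feasible p y -> f x <= f y.
Proof.
move=> [x px] cf.
have [||x' /set_mem px' min_x'] :=
    compact_EVT_min _ (@feasible_compact p) (f := f).
- by exists x.
- exact: continuous_subspaceT.
by exists x' => // y py; apply: min_x'; exact: mem_set.
Qed.

End Compactness.

(** * Moving the threshold to a data point *)

(** The loss of quantile regression at level [beta]: a convex function of [z]
    with slope [- beta] before the data point [y] and [1 - beta] after it. *)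
Definition pinball_loss (R : realType) (beta y z : R) : R :=
  beta * pos_part (y - z) + (1 - beta) * pos_part (z - y).

(** The hypotheses say that moving from [z] to [z'] does not cross the kink
    [y].  They are asymmetric because the slope at [z = y] is taken to be the
    one on the right. *)
Lemma pinball_loss_affine (R : realType) (beta y z z' : R) :
  (y <= z -> y <= z') -> (z < y -> z' <= y) ->
  pinball_loss beta y z' =
    pinball_loss beta y z + (z' - z) * (if y <= z then 1 - beta else - beta).
Proof.
have posE (u : R) : 0 <= u -> pos_part u = u by move=> ?; apply/max_idPl.
have negE (u : R) : u <= 0 -> pos_part u = 0 by move=> ?; apply/max_idPr.
rewrite /pinball_loss; case: leP => [yz /(_ isT) yz' _|zy _ /(_ isT) zy'].
  rewrite (negE (y - z)) ?(negE (y - z')) ?subr_le0 //.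
  by rewrite !posE ?subr_ge0 //; ring.
have zyW := ltW zy.
rewrite (negE (z - y)) ?(negE (z' - y)) ?subr_le0 //.
by rewrite !posE ?subr_ge0 //; ring.
Qed.

(** Moving [z] to the closest data point on either side changes the total loss
    at the constant rate [slope], so one moves against the sign of [slope].  If
    there is no data point on that side, all the individual slopes have the
    same sign, which forces [slope] to vanish or contradicts its sign. *)
Lemma pinball_loss_data_point (R : realType) (I : finType) (i0 : I) (beta : R)
    (w y : I -> R) (z : R) :
  0 <= beta -> beta <= 1 -> (forall i, 0 <= w i) ->
  exists k, \sum_i w i * pinball_loss beta (y i) (y k) <=
            \sum_i w i * pinball_loss beta (y i) z.
Proof.
move=> beta_ge0 beta_le1 w_ge0.
pose slope := \sum_i w i * (if y i <= z then 1 - beta else - beta).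
pose no_worse k := \sum_i w i * pinball_loss beta (y i) (y k) <=
                   \sum_i w i * pinball_loss beta (y i) z.
have move_to k : (forall i, y i <= z -> y i <= y k) ->
    (forall i, z < y i -> y k <= y i) -> (y k - z) * slope <= 0 ->
    exists k, no_worse k.
  move=> below above slope_le0; exists k.
  rewrite /no_worse -subr_le0 -sumrB; apply: le_trans slope_le0.
  rewrite mulr_sumr; apply: ler_sum => i _.
  rewrite (pinball_loss_affine beta (below i) (above i)).
  by rewrite mulrDr addrC addKr mulrCA.
have below_or : (exists i, y i <= z) \/ (forall i, z < y i).
  case: (boolP [exists i, y i <= z]) => [/existsP|/existsPn h]; [by left|right].
  by move=> i; rewrite ltNge.
have above_or : (exists i, z < y i) \/ (forall i, y i <= z).
  case: (boolP [exists i, z < y i]) => [/existsP|/existsPn h]; [by left|right].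
  by move=> i; rewrite leNgt.
have move_down : (exists i, y i <= z) -> 0 <= slope -> exists k, no_worse k.
  move=> [i yi] slope_ge0.
  case: (arg_maxP (P := fun j => y j <= z) y yi) => k yk k_max.
  apply: (move_to k) => //.
    by move=> j /ltW; apply: le_trans.
  by rewrite mulr_le0_ge0 // subr_le0.
have move_up : (exists i, z < y i) -> slope <= 0 -> exists k, no_worse k.
  move=> [i yi] slope_le0.
  case: (arg_minP (P := fun j => z < y j) y yi) => k yk k_min.
  apply: (move_to k) => //.
    by move=> j yj; apply: le_trans (ltW yk).
  by rewrite mulr_ge0_le0 // subr_ge0 ltW.
have [slope_ge0|slope_lt0] := leP 0 slope.
  case: below_or => [ex|all_above]; first exact: move_down.
  (* Here z lies below all the data, so slope is also nonpositive. *)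
  apply: move_up; first by exists i0.
  apply: sumr_le0 => i _.
  by rewrite (lt_geF (all_above i)) mulr_ge0_le0 // oppr_le0.
case: above_or => [ex|all_below]; first by apply: move_up (ltW _).
suff : 0 <= slope by rewrite leNgt slope_lt0.
by apply: sumr_ge0 => i _; rewrite all_below mulr_ge0 // subr_ge0.
Qed.

(** * The objective *)

Section Objective.
Variables (R : realType) (nT : nat) (S A : finType).
Variables (c : 'I_nT -> S -> A -> R) (beta lambda : R).
Local Notation profile := ('I_nT -> S -> A -> R).
Local Notation triple := ('I_nT * S * A)%type.

Lemma objective_triple (x : profile) (eta : R) :
  mdpbl_objective c beta lambda x eta = 1 / nT%:R *
    (\sum_(k : triple) c k.1.1 k.1.2 k.2 * x k.1.1 k.1.2 k.2 +
     \sum_(k : triple) lambda * x k.1.1 k.1.2 k.2 *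
        pinball_loss beta (c k.1.1 k.1.2 k.2) eta).
Proof.
by rewrite -big_split /mdpbl_objective /= pair_bigA pair_bigA.
Qed.

Lemma objective_data_point (t0 : 'I_nT) (s0 : S) (a0 : A) (x : profile)
    (eta : R) :
  0 <= beta -> beta <= 1 -> 0 <= lambda -> (forall t s a, 0 <= x t s a) ->
  exists k : triple, mdpbl_objective c beta lambda x (c k.1.1 k.1.2 k.2) <=
                     mdpbl_objective c beta lambda x eta.
Proof.
move=> beta_ge0 beta_le1 lambda_ge0 x_ge0.
have [|k le_k] := @pinball_loss_data_point R triple (t0, s0, a0) beta
  (fun k => lambda * x k.1.1 k.1.2 k.2) (fun k => c k.1.1 k.1.2 k.2) eta
  beta_ge0 beta_le1.
  by move=> k; rewrite mulr_ge0.
exists k; rewrite !objective_triple ler_wpM2l ?divr_ge0 //.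
by rewrite lerD2l.
Qed.

Import ArrowAsProduct.

Lemma continuous_objective (eta : R) :
  continuous (fun x : profile => mdpbl_objective c beta lambda x eta).
Proof.
rewrite (_ : (fun x => _) = fun x : profile => \sum_t \sum_s \sum_a x t s a *
    ((c t s a + lambda * pinball_loss beta (c t s a) eta) / nT%:R)); last first.
  apply/funext => x; rewrite /mdpbl_objective mulr_sumr.
  apply: eq_bigr => t _; rewrite mulr_sumr; apply: eq_bigr => s _.
  rewrite mulr_sumr; apply: eq_bigr => a _.
  by rewrite /pinball_loss; ring.
do 3 apply: continuous_sum => ?; exact/continuous_mulr/continuous_entry.
Qed.

End Objective.

Theorem proposition3 (R : realType) (nT : nat) (S A : finType)
    (c : 'I_nT -> S -> A -> R) (p : 'I_nT -> S -> A -> S -> R)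
    (beta lambda : R)
    (nT_gt0 : (0 < nT)%N) (S_gt0 : (0 < #|S|)%N) (A_gt0 : (0 < #|A|)%N)
    (hp : transition_probabilities p)
    (beta_gt0 : 0 < beta) (beta_lt1 : beta < 1)
    (hlambda : lambda = 1 / (1 - beta)) :
  exists (x : 'I_nT -> S -> A -> R) (eta : R),
    mdpbl_optimal c p beta lambda x eta /\
    exists (t : 'I_nT) (s : S) (a : A), eta = c t s a.
Proof.
have lambda_ge0 : 0 <= lambda by rewrite hlambda divr_ge0 // subr_ge0 ltW.
move: S_gt0 A_gt0 => /card_gt0P[s0 _] /card_gt0P[a0 _].
pose t0 := Ordinal nT_gt0.
pose cost (k : 'I_nT * S * A) := c k.1.1 k.1.2 k.2.
pose obj := mdpbl_objective c beta lambda.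
pose minimizer k x := feasible p x /\
  forall y, feasible p y -> obj x (cost k) <= obj y (cost k).
have /boolp.choice[xmin xminP] k : exists x, minimizer k x.
  have [x px x_min] := feasible_min (feasible_nonempty t0 s0 a0 hp)
    (@continuous_objective R nT S A c beta lambda (cost k)).
  by exists x.
have [k _ k_min] := @arg_minP _ R _ (t0, s0, a0) xpredT
  (fun k => obj (xmin k) (cost k)) isT.
exists (xmin k), (cost k); split; last by exists k.1.1, k.1.2, k.2.
split=> [|y zeta py]; first exact: (xminP k).1.
have [k' le_k'] := @objective_data_point R nT S A c beta lambda t0 s0 a0 y zeta
  (ltW beta_gt0) (ltW beta_lt1) lambda_ge0 py.1.1.
apply: le_trans le_k'; apply: le_trans (k_min k' isT) _.
exact: (xminP k').2.
Qed.
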